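(* Let $A_2$ act on $H=\mathbb C^3$ by $a=(c_+,c_-)\mapsto \mathrm{diag}(c_+,c_+,c_-)$, let $e=\mathrm{diag}(1,1,0)$, let $\epsilon'\in\{+1,-1\}$, $d_1\in\mathbb C$, and $$D=\begin{pmatrix}0&\epsilon' d_1^*&d_1\\ \epsilon' d_1&0&0\\ d_1^*&0&0\end{pmatrix},\qquad J=\begin{pmatrix}1&0&0\\0&0&1\\0&1&0\end{pmatrix}\circ *,$$ where $*$ denotes componentwise complex conjugation of vectors and $d_1^*$ the complex conjugate of $d_1$. Let $\zeta,\xi>0$, $0\le\rho\le1$, and set $$k=\zeta\big(\rho e+(1-\rho)(1-e)\big),\qquad h=\xi\big((1-\rho)e+\rho(1-e)\big),\qquad k_J=JkJ^{-1}.$$ If $\zeta^2\rho=\xi^2(1-\rho)$, then the conformal rescalings $D_{k_J}=k_JDk_J$ and $D_h=hDh$ coincide, and they correspond to the same twist $$\nu=\begin{pmatrix}1&0&0\\0&\frac{1-\rho}{\rho}&0\\0&0&\frac{\rho}{1-\rho}\end{pmatrix},$$ that is, $\nu=k^{-1}k_J$, and $J$ is a $\nu$-twisted real structure both for $(A_2,\mathbb C^3,D_{k_J})$ and for $(A_2,\mathbb C^3,D_h)$, with the given sign $\epsilon'$.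
   Context: $A_2=\mathbb C^2=\{(c_+,c_-)\}$ is the $*$-algebra of complex functions on two points (componentwise operations, $*$ is complex conjugation), identified with its image as operators on $\mathbb C^3$; $1$ denotes the identity matrix. For a selfadjoint operator $D$ on $H$ and a selfadjoint invertible operator $\nu$ on $H$ with $\nu^{-1}a\nu\in A_2$ for all $a\in A_2$, an anti-linear map $J:H\to H$ is a $\nu$-twisted real structure for $(A_2,H,D)$ with sign $\epsilon'$ if $J^*J=\mathrm{id}$, $J^2=\epsilon\,\mathrm{id}$ for some $\epsilon\in\{+1,-1\}$, and for all $a,b\in A_2$: (i) $[a,JbJ^{-1}]=0$; (ii) $[D,a]\,J\nu^{-2}b\,\nu^2J^{-1}=JbJ^{-1}[D,a]$; (iii) $DJ\nu=\epsilon'\nu JD$; (iv) $\nu J\nu=J$. The grading is $\gamma=\mathrm{diag}(1,-1,-1)$, and it is also required that $\nu^2\gamma=\gamma\nu^2$, that the operator of the triple anticommutes with $\gamma$, and that $\gamma J=\epsilon''J\gamma$ for some sign $\epsilon''$. The twist attached to the conformal rescaling $D\mapsto k_JDk_J$ is the operator $k^{-1}k_J$. The condition $\zeta^2\rho=\xi^2(1-\rho)$ with $\zeta,\xi>0$ forces $0<\rho<1$. *)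

(* Defs.v *)
From HB Require Import structures.
From mathcomp Require Export all_boot all_order all_algebra.
From mathcomp Require Export all_classical reals.
From mathcomp Require Export complex.

Set Implicit Arguments.
Unset Strict Implicit.
Unset Printing Implicit Defensive.

Import Order.TTheory GRing.Theory Num.Theory.

#[export] Set Implicit Arguments.
#[export] Unset Strict Implicit.
#[export] Unset Printing Implicit Defensive.

Local Open Scope classical_set_scope.
Local Open Scope ring_scope.
Local Open Scope complex_scope.

Section Operators.
Variables (R : realType) (n : nat).
Local Notation H := 'cV[R[i]]_n.

(* Operators are plain maps, so that linear and anti-linear ones compose. *)
Definition operator := H -> H.

Implicit Types (S T : operator) (A : set operator).

(* Anti-linear in the first argument, linear in the second. *)
Definition dotu (u v : H) : R[i] := \sum_(i < n) conjc (u i 0) * v i 0.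

Definition is_linear T :=
  forall (c : R[i]) (u v : H), T (c *: u + v) = c *: T u + T v.

Definition is_antilinear T :=
  forall (c : R[i]) (u v : H), T (c *: u + v) = conjc c *: T u + T v.

Definition selfadjoint T :=
  is_linear T /\ forall u v, dotu (T u) v = dotu u (T v).

(* Adjoint of an anti-linear operator: <J^* u, v> = <J v, u>. *)
Definition is_antiadjoint T S := forall u v, dotu (S u) v = dotu (T v) u.

(* Inverse of T; meaningful only when T is bijective. *)
Definition opinv T : operator := fun w => xget 0 [set v | T v = w].

Definition opcomm S T : operator := (S \o T) \- (T \o S).

Definition opmx (M : 'M[R[i]]_n) : operator := fun v => M *m v.

Definition is_sign (c : R[i]) := c = 1 \/ c = -1.

(* The algebra is given by its image A in the operators on H, [gamma] is the
   grading. *)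
Record twisted_real_structure A (D gamma nu J : operator) (eps' : R[i]) :
    Prop := TwistedRealStructure {
  trs_D_sa : selfadjoint D ;
  trs_nu_sa : selfadjoint nu ;
  trs_nu_bij : bijective nu ;
  trs_nu_A : forall a, A a -> A (opinv nu \o a \o nu) ;
  trs_J_anti : is_antilinear J ;
  trs_J_isom : exists2 Js, is_antiadjoint J Js & Js \o J = id ;
  trs_J_sq : exists2 eps, is_sign eps & J \o J = eps \*: id ;
  trs_sign : is_sign eps' ;
  trs_order0 : forall a b, A a -> A b ->
    opcomm a (J \o b \o opinv J) = (fun=> 0) ;
  trs_order1 : forall a b, A a -> A b ->
    opcomm D a \o J \o opinv nu \o opinv nu \o b \o nu \o nu \o opinv J
    = J \o b \o opinv J \o opcomm D a ;
  trs_DJ : D \o J \o nu = eps' \*: (nu \o J \o D) ;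
  trs_nuJ : nu \o J \o nu = J ;
  trs_nu_gamma : nu \o nu \o gamma = gamma \o nu \o nu ;
  trs_D_gamma : D \o gamma = -1 \*: (gamma \o D) ;
  trs_J_gamma : exists2 eps'', is_sign eps'' &
    gamma \o J = eps'' \*: (J \o gamma)
}.

End Operators.

Section TwoPoints.
Variable R : realType.
Local Notation C := R[i].

Definition mx3 (s : seq (seq C)) : 'M[C]_3 :=
  \matrix_(i < 3, j < 3) (nth [::] s i)`_j.

Definition diag3 (x y z : C) : 'M[C]_3 :=
  mx3 [:: [:: x; 0; 0]; [:: 0; y; 0]; [:: 0; 0; z]].

Definition A2_rep (a : C * C) : operator R 3 := opmx (diag3 a.1 a.1 a.2).

Definition A2 : set (operator R 3) := range A2_rep.

Definition e_mx : 'M[C]_3 := diag3 1 1 0.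

Definition gamma_op : operator R 3 := opmx (diag3 1 (-1) (-1)).

Definition D_op (eps' d1 : C) : operator R 3 :=
  opmx (mx3 [:: [:: 0;         eps' * conjc d1; d1];
                [:: eps' * d1; 0;               0];
                [:: conjc d1;  0;               0]]).

Definition J_op : operator R 3 :=
  opmx (mx3 [:: [:: 1; 0; 0]; [:: 0; 0; 1]; [:: 0; 1; 0]])
  \o map_mx (@conjc R).

Definition k_op (zeta rho : R) : operator R 3 :=
  opmx (zeta%:C *: (rho%:C *: e_mx + (1 - rho)%:C *: (1 - e_mx))).

Definition h_op (xi rho : R) : operator R 3 :=
  opmx (xi%:C *: ((1 - rho)%:C *: e_mx + rho%:C *: (1 - e_mx))).

Definition nu_op (rho : R) : operator R 3 :=
  opmx (diag3 1 ((1 - rho) / rho)%:C (rho / (1 - rho))%:C).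

End TwoPoints.

(* Main.v *)
Require Import Defs.
From mathcomp Require Import ring.
Import Order.TTheory GRing.Theory Num.Theory.
Local Open Scope ring_scope.
Local Open Scope complex_scope.

(** In coordinates [k_J = zeta diag(rho, 1 - rho, rho)], and the hypothesis
    turns both rescalings into the matrix with first row
    [(0, eps' (1 - rho) d^*, rho d)], [d = zeta^2 rho d1], and the Hermitian
    conjugate first column. For such a matrix every axiom is an entrywise
    identity; the first-order condition holds because [nu] commutes with
    [A_2] and [[D, a]] only mixes the first and third basis vectors, on which
    [J b J^-1] is scalar. *)

(** * Operators on [C^3] evaluated on coordinate vectors *)

Section Coordinates.
Variable R : realType.
Local Notation C := R[i].
Implicit Types (x y z : C).

Definition vec3 x y z : 'cV[C]_3 := \col_(i < 3) [:: x; y; z]`_i.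

Lemma vec3_surj (v : 'cV[C]_3) :
  v = vec3 (v 0 0) (v (inord 1) 0) (v (inord 2) 0).
Proof.
apply/colP => i; rewrite mxE.
by case: i => [[|[|[|//]]] ?] /=; congr (v _ _); apply/val_inj; rewrite /= ?inordK.
Qed.

(** Neither map is assumed linear, so identities involving the anti-linear [J] are also reduced to
    coordinates here. *)
Lemma operator3_ext (S T : operator R 3) :
  (forall x y z, S (vec3 x y z) = T (vec3 x y z)) -> S = T.
Proof. by move=> ST; apply/funext => v; rewrite (vec3_surj v). Qed.

Lemma opmx_mx3_vec3 a b c d e f g h l x y z :
  opmx (mx3 [:: [:: a; b; c]; [:: d; e; f]; [:: g; h; l]]) (vec3 x y z) =
  vec3 (a * x + b * y + c * z) (d * x + e * y + f * z) (g * x + h * y + l * z).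
Proof.
apply/colP => i; rewrite !mxE !big_ord_recl big_ord0 !mxE /=.
by case: i => [[|[|[|//]]] ?] /=; rewrite addr0 addrA.
Qed.

Lemma opmx_diag3_vec3 a b c x y z :
  opmx (diag3 a b c) (vec3 x y z) = vec3 (a * x) (b * y) (c * z).
Proof. by rewrite opmx_mx3_vec3 !mul0r !addr0 !add0r. Qed.

Lemma J_vec3 x y z : J_op (vec3 x y z) = vec3 (conjc x) (conjc z) (conjc y).
Proof.
have -> : J_op (vec3 x y z) =
    opmx (mx3 [:: [:: 1; 0; 0]; [:: 0; 0; 1]; [:: 0; 1; 0]])
      (vec3 (conjc x) (conjc y) (conjc z)).
  rewrite /J_op /=; congr opmx; apply/colP => i; rewrite !mxE.
  by case: i => [[|[|[|//]]] ?].
by rewrite opmx_mx3_vec3 !mul0r !mul1r !addr0 !add0r.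
Qed.

Lemma scale_vec3 c x y z : c *: vec3 x y z = vec3 (c * x) (c * y) (c * z).
Proof. by apply/colP => i; rewrite !mxE; case: i => [[|[|[|//]]] ?]. Qed.

Lemma add_vec3 x y z x' y' z' :
  vec3 x y z + vec3 x' y' z' = vec3 (x + x') (y + y') (z + z').
Proof. by apply/colP => i; rewrite !mxE; case: i => [[|[|[|//]]] ?]. Qed.

Lemma opp_vec3 x y z : - vec3 x y z = vec3 (- x) (- y) (- z).
Proof. by apply/colP => i; rewrite !mxE; case: i => [[|[|[|//]]] ?]. Qed.

Lemma vec30 : 0 = vec3 0 0 0.
Proof. by apply/colP => i; rewrite !mxE; case: i => [[|[|[|//]]] ?]. Qed.

Lemma dotu_vec3 x y z x' y' z' :
  dotu (vec3 x y z) (vec3 x' y' z') =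
  conjc x * x' + conjc y * y' + conjc z * z'.
Proof. by rewrite /dotu !big_ord_recl big_ord0 !mxE /= addr0 addrA. Qed.

Definition vec3E :=
  (opmx_diag3_vec3, opmx_mx3_vec3, J_vec3, opp_vec3, scale_vec3, add_vec3).

End Coordinates.

(** * Computing the inverse chosen by [opinv] *)

Section Inverse.
Variables (R : realType) (n : nat).
Implicit Types S T : operator R n.

(** [S w] is a preimage of [w], so the choice made by [opinv] is a genuine preimage, and injectivity
    of [T] makes it equal to [S w]. *)
Lemma opinv_cancel S T : cancel S T -> cancel T S -> opinv T = S.
Proof.
move=> ST TS; apply/funext => w; rewrite /opinv.
have := @xgetI _ 0 [set v | T v = w]%classic (S w) (ST w).
by move=> /= /(congr1 S); rewrite TS.
Qed.

Lemma opmx_linear (M : 'M[R[i]]_n) : is_linear (opmx M).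
Proof. by move=> c u v; rewrite /opmx mulmxDr -scalemxAr. Qed.

End Inverse.

(** * The axioms for a weighted Dirac operator *)

Section TwoPointStructure.
Variable R : realType.
Local Notation C := R[i].

Lemma conjcD (x y : C) : conjc (x + y) = conjc x + conjc y.
Proof. exact: rmorphD. Qed.

Lemma conjcM (x y : C) : conjc (x * y) = conjc x * conjc y.
Proof. exact: rmorphM. Qed.

Lemma conjcN (x : C) : conjc (- x) = - conjc x.
Proof. exact: rmorphN. Qed.

Definition conjcE := (conjcK, conjc_real, conjc_inv, conjc0, conjc1,
  conjcD, conjcM, conjcN).

Lemma conjc_sign (eps : C) : is_sign eps -> conjc eps = eps.
Proof. by case=> ->; rewrite !conjcE. Qed.

Lemma J_opK : involutive (@J_op R).
Proof. by move=> v; rewrite (vec3_surj v) !vec3E !conjcK. Qed.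

Lemma opinv_J : opinv (@J_op R) = @J_op R.
Proof. exact: opinv_cancel J_opK J_opK. Qed.

Lemma diag3K (a b c : C) : a != 0 -> b != 0 -> c != 0 ->
  cancel (opmx (diag3 a b c)) (opmx (diag3 a^-1 b^-1 c^-1)).
Proof. by move=> a0 b0 c0 v; rewrite (vec3_surj v) !vec3E !mulKf. Qed.

Lemma diag3VK (a b c : C) : a != 0 -> b != 0 -> c != 0 ->
  cancel (opmx (diag3 a^-1 b^-1 c^-1)) (opmx (diag3 a b c)).
Proof. by move=> a0 b0 c0 v; rewrite (vec3_surj v) !vec3E !mulVKf. Qed.

Lemma opinv_diag3 (a b c : C) : a != 0 -> b != 0 -> c != 0 ->
  opinv (opmx (diag3 a b c)) = opmx (diag3 a^-1 b^-1 c^-1).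
Proof.
by move=> a0 b0 c0; exact: opinv_cancel (diag3VK a0 b0 c0) (diag3K a0 b0 c0).
Qed.

(** [J] swaps the last two coordinates and conjugates. As [J] is its own inverse, this computes both
    [J b J^-1] and [k_J]. *)
Lemma J_diag3_J (a b c : C) :
  @J_op R \o opmx (diag3 a b c) \o @J_op R =
  opmx (diag3 (conjc a) (conjc c) (conjc b)).
Proof. by apply: operator3_ext => x y z; rewrite /= !vec3E !conjcE. Qed.

Lemma diag3_selfadjoint (a b c : R) :
  selfadjoint (opmx (diag3 a%:C b%:C c%:C)).
Proof.
split; first exact: opmx_linear.
move=> u v; rewrite (vec3_surj u) (vec3_surj v) !vec3E !dotu_vec3.
by rewrite !conjcE; ring.
Qed.

(** Common shape of both rescalings: [q] weights the pair of entries joining coordinates 1 and 2,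
    [p] the pair joining 1 and 3. *)
Definition rescaled_D (eps' d : C) (p q : R) : operator R 3 :=
  opmx (mx3 [:: [:: 0; eps' * q%:C * conjc d; p%:C * d];
                [:: eps' * q%:C * d; 0; 0];
                [:: p%:C * conjc d; 0; 0]]).

(** Moving [D] past [J] exchanges the weights [p] and [q]; the ratios [q / p] and [p / q] in the
    twist undo this. They are real and mutually inverse, whence [nu J nu = J]. *)
Lemma rescaled_D_twisted (eps' d : C) (p q : R) :
  is_sign eps' -> p != 0 -> q != 0 ->
  twisted_real_structure (@A2 R) (rescaled_D eps' d p q) (@gamma_op R)
    (opmx (diag3 1 (q / p)%:C (p / q)%:C)) (@J_op R) eps'.
Proof.
move=> heps p0 q0.
have ceps := conjc_sign heps.
have pC0 : p%:C != 0 by rewrite fmorph_eq0.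
have qC0 : q%:C != 0 by rewrite fmorph_eq0.
have qp0 : (q / p)%:C != 0 by rewrite fmorph_eq0 mulf_neq0 ?invr_eq0.
have pq0 : (p / q)%:C != 0 by rewrite fmorph_eq0 mulf_neq0 ?invr_eq0.
have one0 : (1 : C) != 0 := oner_neq0 _.
have qpE : (q / p)%:C = q%:C / p%:C by rewrite fmorph_div.
have pqE : (p / q)%:C = p%:C / q%:C by rewrite fmorph_div.
split=> //.
- split; first exact: opmx_linear.
  move=> u v; rewrite /rescaled_D (vec3_surj u) (vec3_surj v) !vec3E !dotu_vec3.
  by rewrite !conjcE ceps; ring.
- exact: (diag3_selfadjoint 1).
- exact: Bijective (diag3K one0 qp0 pq0) (diag3VK one0 qp0 pq0).
(* Conjugation by the diagonal [nu] fixes every diagonal operator, so [a] itself is the witness. *)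
- move=> _ [a _ <-]; exists a => //; rewrite opinv_diag3 //.
  apply: operator3_ext => x y z; rewrite /A2_rep /= !vec3E.
  by congr vec3; rewrite ?invr1 ?mul1r // mulrCA mulKf.
- move=> c u v; rewrite (vec3_surj u) (vec3_surj v) !vec3E.
  by rewrite !conjcE.
(* [J] is its own anti-linear adjoint. *)
- exists (@J_op R); last exact/funext/J_opK.
  move=> u v; rewrite (vec3_surj u) (vec3_surj v) !vec3E !dotu_vec3.
  by rewrite !conjcK; ring.
- exists 1; first by left.
  by apply/funext => v; rewrite /= J_opK scale1r.
- move=> _ _ [a _ <-] [b _ <-]; rewrite opinv_J J_diag3_J.
  apply: operator3_ext => x y z; rewrite /opcomm /A2_rep /= !vec3E vec30.
  by congr vec3; ring.
- move=> _ _ [a _ <-] [b _ <-]; rewrite opinv_J opinv_diag3 // invr1.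
  apply: operator3_ext => x y z.
  rewrite /opcomm /A2_rep /rescaled_D /= !vec3E.
  rewrite qpE pqE !conjcE.
  by congr vec3; field; rewrite ?pC0 ?qC0.
- apply: operator3_ext => x y z; rewrite /rescaled_D /= !vec3E.
  rewrite qpE pqE !conjcE ceps.
  (* The identity needs [eps' ^+ 2 = 1], supplied by fixing the sign. *)
  by case: heps => ->; congr vec3; field; rewrite ?pC0 ?qC0.
- apply: operator3_ext => x y z; rewrite /= !vec3E.
  rewrite qpE pqE !conjcE.
  by congr vec3; field; rewrite ?pC0 ?qC0.
- by apply: operator3_ext => x y z; rewrite /gamma_op /= !vec3E; congr vec3; ring.
- apply: operator3_ext => x y z; rewrite /gamma_op /rescaled_D /= !vec3E.
  by congr vec3; ring.
(* [gamma] is real and equal on the two coordinates that [J] swaps, so they commute. *)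
- exists 1; first by left.
  apply: operator3_ext => x y z; rewrite /gamma_op /= !vec3E.
  by rewrite !conjcE; congr vec3; ring.
Qed.

(** * The rescaling operators as diagonal matrices *)

Lemma e_mx_combination (s x y : C) :
  s *: (x *: @e_mx R + y *: (1 - @e_mx R)) = diag3 (s * x) (s * x) (s * y).
Proof.
apply/matrixP => i j; rewrite !mxE.
by case: i j => [[|[|[|//]]] ?] [[|[|[|//]]] ?] /=; ring.
Qed.

Lemma k_opE (zeta rho : R) :
  k_op zeta rho = opmx (diag3 (zeta * rho)%:C (zeta * rho)%:C
                              (zeta * (1 - rho))%:C).
Proof. by rewrite /k_op e_mx_combination -!rmorphM. Qed.

Lemma h_opE (xi rho : R) :
  h_op xi rho = opmx (diag3 (xi * (1 - rho))%:C (xi * (1 - rho))%:C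
                            (xi * rho)%:C).
Proof. by rewrite /h_op e_mx_combination -!rmorphM. Qed.

(** Each entry of [D] is multiplied by the two matching diagonal entries. [D] has no entry joining
    coordinates 2 and 3, so only [a * b] and [a * c] matter, and their common real factor [s] is
    absorbed into [d1]. *)
Lemma diag3_D_diag3 (eps' d1 : C) (a b c s p q : R) :
  a * b = s * q -> a * c = s * p ->
  opmx (diag3 a%:C b%:C c%:C) \o D_op eps' d1 \o opmx (diag3 a%:C b%:C c%:C) =
  rescaled_D eps' (s%:C * d1) p q.
Proof.
move=> /(congr1 (fun x => x%:C)) ab /(congr1 (fun x => x%:C)) ac.
move: ab ac; rewrite !rmorphM => ab ac.
apply: operator3_ext => x y z; rewrite /D_op /rescaled_D /= !vec3E.
rewrite !conjcE; congr vec3; rewrite !(mul0r, addr0, add0r).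
(* Regrouped to expose the products [a * b] and [a * c]. *)
- transitivity (a%:C * b%:C * eps' * conjc d1 * y + a%:C * c%:C * d1 * z).
    by ring.
  by rewrite ab ac; ring.
- transitivity (a%:C * b%:C * eps' * d1 * x); first by ring.
  by rewrite ab; ring.
- transitivity (a%:C * c%:C * conjc d1 * x); first by ring.
  by rewrite ac; ring.
Qed.

End TwoPointStructure.

Theorem lemma4p2 (R : realType) (eps' d1 : R[i]) (zeta xi rho : R)
    (heps' : is_sign eps') (hzeta : 0 < zeta) (hxi : 0 < xi)
    (hrho0 : 0 <= rho) (hrho1 : rho <= 1)
    (hrho : zeta ^+ 2 * rho = xi ^+ 2 * (1 - rho)) :
  let D := D_op eps' d1 in
  let J := @J_op R in
  let k := k_op zeta rho in
  let h := h_op xi rho in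
  let kJ := J \o k \o opinv J in
  let DkJ := kJ \o D \o kJ in
  let Dh := h \o D \o h in
  let nu := nu_op rho in
  [/\ DkJ = Dh,
      nu = opinv k \o kJ,
      twisted_real_structure (@A2 R) DkJ (@gamma_op R) nu J eps' &
      twisted_real_structure (@A2 R) Dh (@gamma_op R) nu J eps'].
Proof.
move=> D J k h kJ DkJ Dh nu.
have z0 : zeta != 0 by rewrite gt_eqF.
have x0 : xi != 0 by rewrite gt_eqF.
(* At either endpoint the balance [hrho] would force [xi] or [zeta] to vanish. *)
have r0 : rho != 0.
  apply: contra_neq x0 => r0; apply/eqP; rewrite -sqrf_eq0.
  by move: hrho; rewrite r0 mulr0 subr0 mulr1 => <-.
have r1 : 1 - rho != 0.
  apply: contra_neq z0 => r1; apply/eqP; rewrite -sqrf_eq0.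
  have {r1} r1 : rho = 1 by apply/esym/eqP; rewrite -subr_eq0 r1.
  by move: hrho; rewrite r1 subrr mulr0 mulr1 => ->.
have kJE : kJ = opmx (diag3 (zeta * rho)%:C (zeta * (1 - rho))%:C
                            (zeta * rho)%:C).
  by rewrite /kJ /k opinv_J k_opE J_diag3_J !conjc_real.
have DkJE : DkJ = rescaled_D eps' ((zeta ^+ 2 * rho)%:C * d1) rho (1 - rho).
  by rewrite /DkJ kJE; apply: diag3_D_diag3; ring.
(* The products for [h] have common factor [xi ^+ 2 * (1 - rho)], which [hrho] identifies with the
   factor for [k_J]. *)
have DhE : Dh = rescaled_D eps' ((zeta ^+ 2 * rho)%:C * d1) rho (1 - rho).
  by rewrite /Dh /h h_opE hrho; apply: diag3_D_diag3; ring.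
have trs := rescaled_D_twisted ((zeta ^+ 2 * rho)%:C * d1) heps' r0 r1.
rewrite DkJE DhE; split=> //.
(* Only [nu = k^-1 k_J] remains; [zeta] cancels in the entrywise quotients. *)
rewrite kJE /nu /nu_op /k k_opE.
rewrite opinv_diag3 ?fmorph_eq0 ?mulf_neq0 //.
apply: operator3_ext => x y w; rewrite /= !vec3E.
have zC0 : zeta%:C != 0 by rewrite fmorph_eq0.
have rC0 : rho%:C != 0 by rewrite fmorph_eq0.
have rC1 : 1 - rho%:C != 0.
  by rewrite -(rmorph1 (real_complex R)) -rmorphB fmorph_eq0.
rewrite !fmorph_div !rmorphM rmorphB rmorph1.
by congr vec3; field; rewrite ?rC0 ?rC1 zC0.
Qed.
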